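(* Let $\Delta$ be a positive integer and let $G$ be a finite simple graph of maximum degree at most $\Delta$ such that no connected component of $G$ has order at most $2$. Then $$\nu_s^*(G) \leq \frac{\Delta}{2\Delta+1}\, n(G),$$ with equality if and only if each connected component of $G$ is isomorphic to $T^*$.
   Context: For a graph $G$, $n(G)$ is its number of vertices. For a vertex $u$, $\delta_G(u)$ is the set of edges incident with $u$; for an edge $uv$, $\delta_G(uv)=\delta_G(u)\cup\delta_G(v)$. The fractional induced matching number $\nu_s^*(G)$ is the optimum value of the linear program: maximize $\sum_{e\in E(G)} x_e$ subject to $\sum_{f\in\delta_G(e)} x_f\le 1$ for every $e\in E(G)$ and $x_e\ge 0$ for every $e\in E(G)$. $T^*$ denotes the tree obtained from the star $K_{1,\Delta}$ (of order $\Delta+1$) by subdividing each edge exactly once. *)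

(* Defs.v *)
From mathcomp Require Import all_boot all_order all_algebra.
From mathcomp Require Import boolp classical_sets reals.
From mathcomp Require Import topology normedtype derive.

Set Implicit Arguments.
Unset Strict Implicit.
Unset Printing Implicit Defensive.

Import Order.TTheory GRing.Theory Num.Theory.
Local Open Scope ring_scope.

Record sgraph := SGraph {
  vertex :> finType;
  adj : rel vertex;
  adj_sym : symmetric adj;
  adj_irr : irreflexive adj }.

Section Basic.
Variable G : sgraph.

Definition degree (v : G) : nat := #|[set w : G | adj v w]|.

Definition max_degree : nat := \max_(v : G) degree v.

Definition edges : {set {set G}} :=
  [set [set p.1; p.2] | p : G * G & adj p.1 p.2].

Definition components : {set {set G}} :=
  equivalence_partition (connect (@adj G)) [set: G].

Definition vdelta (u : G) : {set {set G}} := [set f in edges | u \in f].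

Definition edelta (e : {set G}) : {set {set G}} := \bigcup_(u in e) vdelta u.

End Basic.

Arguments edges : clear implicits.
Arguments components : clear implicits.
Arguments max_degree : clear implicits.

Definition isomorphic (G H : sgraph) : Prop :=
  exists2 f : G -> H, bijective f & forall x y : G, adj (f x) (f y) = adj x y.

Section Induced.
Variables (G : sgraph) (A : {set G}).

Definition induced_adj : rel {x : G | x \in A} :=
  fun x y => adj (val x) (val y).

Lemma induced_adj_sym : symmetric induced_adj.
Proof. by move=> x y; rewrite /induced_adj adj_sym. Qed.

Lemma induced_adj_irr : irreflexive induced_adj.
Proof. by move=> x; rewrite /induced_adj adj_irr. Qed.

Definition induced : sgraph := SGraph induced_adj_sym induced_adj_irr.

End Induced.

(* The star K_{1,n}: [None] is the centre, the [Some i] are the leaves. *)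
Section Star.
Variable n : nat.

Definition star_adj : rel (option 'I_n) := fun x y => (x == None) != (y == None).

Lemma star_adj_sym : symmetric star_adj.
Proof. by move=> x y; rewrite /star_adj eq_sym. Qed.

Lemma star_adj_irr : irreflexive star_adj.
Proof. by move=> x; rewrite /star_adj eqxx. Qed.

Definition star : sgraph := SGraph star_adj_sym star_adj_irr.

End Star.

(* Subdividing every edge of G exactly once: each edge e of G becomes a new   *)
(* vertex [inr e], adjacent exactly to the two ends of e.                     *)
Section Subdivision.
Variable G : sgraph.

Definition subdivision_adj : rel (G + {e : {set G} | e \in edges G})%type :=
  fun a b => match a, b with
             | inl u, inr e | inr e, inl u => u \in val e
             | _, _ => false
             end.

Lemma subdivision_adj_sym : symmetric subdivision_adj.
Proof. by move=> [u|e] [v|f]. Qed.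

Lemma subdivision_adj_irr : irreflexive subdivision_adj.
Proof. by move=> [u|e]. Qed.

Definition subdivision : sgraph :=
  SGraph subdivision_adj_sym subdivision_adj_irr.

End Subdivision.

Definition Tstar (n : nat) : sgraph := subdivision (star n).

(* Only the values of x on edges of G matter. *)
Definition feasible (R : realType) (G : sgraph) (x : {set G} -> R) : Prop :=
  (forall e, e \in edges G -> \sum_(f in edelta e) x f <= 1) /\
  (forall e, e \in edges G -> 0 <= x e).

Definition lp_value (R : realType) (G : sgraph) (x : {set G} -> R) : R :=
  \sum_(e in edges G) x e.

(* The supremum is a maximum: see frac_induced_matching_max.                  *)
Definition frac_induced_matching (R : realType) (G : sgraph) : R :=
  sup [set @lp_value R G x | x in @feasible R G]%classic.

Section Maximum.
Import numFieldNormedType.Exports.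
Local Open Scope classical_set_scope.
Variables (R : realType) (G : sgraph).

Local Notation feas := (@feasible R G).
Local Notation lpv := (@lp_value R G).
Local Notation T := (prod_topology (fun _ : {set G} => R)).

Let cube : set T := [set x | forall e, `[0, 1] (x e)].

Let domain : set T := ([set x | feas x] : set T) `&` cube.

Lemma sum_continuous (A : {set {set G}}) :
  continuous (fun x : T => \sum_(e in A) x e).
Proof.
apply: continuous_big => [|e _]; last exact: (@proj_continuous _ (fun=> R)).
exact: add_continuous.
Qed.

Lemma mem_edelta (e : {set G}) : e \in edges G -> e \in edelta e.
Proof.
move=> eE; have [[u v] /= _ defe] := imsetP eE.
apply/finset.bigcupP; exists u; first by rewrite defe !inE eqxx.
by rewrite inE eE defe !inE eqxx.
Qed.

Lemma edelta_edges (e f : {set G}) : f \in edelta e -> f \in edges G.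
Proof. by case/finset.bigcupP=> u _; rewrite inE => /andP[]. Qed.

Lemma feasible_le1 (x : {set G} -> R) (e : {set G}) :
  feas x -> e \in edges G -> x e <= 1.
Proof.
move=> [x1 x0] eE; apply: le_trans (x1 _ eE).
rewrite (bigD1 e) ?mem_edelta//= lerDl.
apply: sumr_ge0 => f /andP[/edelta_edges fE _].
exact: x0.
Qed.

Lemma feasible_closed : closed ([set x | feas x] : set T).
Proof.
have -> : [set x | feas x] =
    (\bigcap_(e in [set e | e \in edges G])
       ((fun x : T => \sum_(f in edelta e) x f) @^-1` [set y | y <= 1])) `&`
    (\bigcap_(e in [set e | e \in edges G])
       ((fun x : T => x e) @^-1` [set y | 0 <= y])) :> set T.
  by apply/seteqP; split=> x [].
apply: closedI; apply: closed_bigI => e _; apply: preimage_closed.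
- by move=> x _; exact: sum_continuous.
- exact: closed_le.
- by move=> x _; exact: (@proj_continuous _ (fun=> R)).
- exact: closed_ge.
Qed.

Lemma frac_induced_matching_max :
  (exists2 x, feas x & lpv x = frac_induced_matching R G) /\
  forall x, feas x -> lpv x <= frac_induced_matching R G.
Proof.
have cpt : compact domain.
  apply: (@subclosed_compact T _ cube); last by move=> x [].
    apply: closedI; first exact: feasible_closed.
    have -> : cube = \bigcap_e ((fun x : T => x e) @^-1` `[0, 1]).
      by apply/seteqP; split=> x xP e; [move=> _|]; exact: xP.
    apply: closed_bigI => e _; apply: preimage_closed.
      by move=> x _; exact: (@proj_continuous _ (fun=> R)).
    exact: interval_closed.
  apply: (@tychonoff _ (fun=> R) (fun=> `[0, 1])) => e.
  exact: segment_compact.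
have ne : domain !=set0.
  exists (fun=> 0); split; last by move=> e /=; rewrite in_itv/= lexx ler01.
  by split=> e eE //; rewrite big1.
have ctn : {within domain, continuous (lpv : T -> R)}.
  by apply: continuous_subspaceT; exact: sum_continuous.
have [c] := compact_EVT_max ne cpt ctn.
rewrite inE => -[cF _] cmax.
have cub x : feas x -> lpv x <= lpv c.
  move=> xF; pose y e : R := if e \in edges G then x e else 0.
  have yx : {in edges G, y =1 x} by move=> e; rewrite /y => ->.
  have -> : lpv x = lpv y by apply: eq_bigr => e /yx.
  apply: cmax; rewrite inE; split.
    split=> e eE; last by rewrite yx //; exact: xF.2.
    rewrite (eq_bigr x) => [|f /edelta_edges /yx //]; exact: xF.1.
  move=> e /=; rewrite in_itv/= /y.
  case: ifP => [eE|_]; last by rewrite lexx ler01.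
  by rewrite xF.2 //= feasible_le1.
suff <- : lpv c = frac_induced_matching R G by split=> //; exists c.
apply/eqP; rewrite eq_le; apply/andP; split.
  apply: ub_le_sup; last by exists c.
  by exists (lpv c) => _ [x xF <-]; exact: cub.
by apply: ge_sup; [exists (lpv c), c | move=> _ [x xF <-]; exact: cub].
Qed.

End Maximum.

(* Main.v *)
(* Let load(u) be the sum of x over the edges at u and d(u) = 1 - load(u) >= 0, *)
(* so that 2 * lp_value x = n - sum d. Feasibility at uv says                  *)
(* d(u) + d(v) >= 1 - x(uv), and adding this over the edges at u gives         *)
(*   (deg u - 1) d(u) + sum_(v ~ u) d(v) >= deg u - 1.                         *)
(* Let S be the sum of d over a component C. A vertex of degree at least 2     *)
(* yields S >= 1; summing over all u in C yields                               *)
(* (2 Delta - 1) S >= sum (deg u - 1) >= |C| - 2, as C has at least |C| - 1    *)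
(* edges. The first estimate is the better one for |C| <= 2 Delta + 1, the     *)
(* second one otherwise, and together (2 Delta + 1) S >= |C|, with equality    *)
(* only if |C| = 2 Delta + 1 and S = 1. In that case a vertex v with d(v) > 0  *)
(* has degree Delta, is adjacent to all other vertices of degree 2, and is the *)
(* only vertex of degree 3 or more, which forces C to be T*. Conversely, the   *)
(* edges avoiding the centres of the copies of T* form an optimal solution.    *)

Require Import Defs.
From mathcomp Require Import all_boot all_order all_algebra.
From mathcomp Require Import reals.
From mathcomp Require Import zify ring lra.

Import Order.TTheory GRing.Theory Num.Theory.
Local Open Scope ring_scope.

Set Implicit Arguments.
Unset Strict Implicit.

(** The upper bound is additive over components. By [sum_load], an optimal solution falls short of
    half the order by half the total deficit, so it suffices to bound the deficit of each component
    from below. Two estimates do this: a local one at a vertex of degree at least 2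
    ([sum_deficit_ge1]) and a global one from double counting ([sum_weighted_deficit]). They cross
    exactly at order 2 Delta + 1, which is why [component_bound] can be tight only there.

    In the tight case [component_center] extracts a centre together with degree constraints, from
    which [component_iso] rebuilds the subdivided star. Conversely, deleting the centres of the
    copies of T* leaves a perfect matching, and weight 1 on its edges attains the bound
    ([frac_induced_matching_ge]). *)

Lemma set2_inj (T : finType) (u v w : T) :
  [set u; v] = [set u; w] -> v = w.
Proof.
move=> e; have /set2P[vu|//] : v \in [set u; w] by rewrite -e set22.
have /set2P[wu|//] : w \in [set u; v] by rewrite e set22.
by rewrite vu wu.
Qed.

Lemma adj_neq (G : sgraph) (u v : G) : adj u v -> u != v.
Proof. by apply: contraTneq => ->; rewrite adj_irr. Qed.

Lemma edgesP (G : sgraph) (e : {set G}) :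
  reflect (exists p : G * G, adj p.1 p.2 /\ e = [set p.1; p.2]) (e \in edges G).
Proof.
apply: (iffP imsetP) => [[p]|[p [pa ->]]]; last by exists p; rewrite ?inE.
by rewrite inE => pa ->; exists p.
Qed.

Lemma adj_edge (G : sgraph) (u v : G) : adj u v -> [set u; v] \in edges G.
Proof. by move=> uv; apply/edgesP; exists (u, v). Qed.

Lemma vdeltaE (G : sgraph) (u : G) :
  vdelta u = [set [set u; v] | v in [set v | adj u v]].
Proof.
apply/setP => e; rewrite inE; apply/andP/imsetP.
  move=> [/edgesP[[a b]/= [ab ->]] /set2P[->|->]]; first by exists b; rewrite ?inE.
  by exists a; rewrite ?inE 1?adj_sym // setUC.
by move=> [v]; rewrite inE => uv ->; rewrite adj_edge // set21.
Qed.

(** * Vertex loads *)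

Section VertexLoad.
Variables (R : realType) (G : sgraph) (x : {set G} -> R).

Definition load (u : G) : R := \sum_(v | adj u v) x [set u; v].

Lemma sum_vdelta (u : G) : \sum_(f in vdelta u) x f = load u.
Proof.
rewrite vdeltaE big_imset /=; last by move=> v w _ _; exact: set2_inj.
by apply: eq_bigl => v; rewrite inE.
Qed.

(** Inclusion-exclusion: the stars of two adjacent vertices share only the edge joining them. *)
Lemma sum_edelta (u v : G) : adj u v ->
  \sum_(f in edelta [set u; v]) x f = load u + load v - x [set u; v].
Proof.
move=> uv; have -> : edelta [set u; v] = vdelta u :|: vdelta v.
  by rewrite /edelta bigcup_setU !big_set1.
have I : vdelta u :&: vdelta v = [set [set u; v]].
  apply/setP => e; rewrite !inE; apply/idP/eqP => [|->]; last first.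
    by rewrite adj_edge // set21 set22.
  have nuv := adj_neq uv.
  move=> /andP[/andP[/edgesP[[a b]/= [_ ->]]]].
  by move=> /set2P[uE|uE] /andP[_ /set2P[vE|vE]];
    move: nuv; rewrite uE vE ?eqxx // setUC.
rewrite -!sum_vdelta (big_setID (vdelta u)) /= setUK.
rewrite setDUl setDv set0U (big_setID (vdelta u) (A := vdelta v)) /=.
by rewrite setIC I big_set1; ring.
Qed.

Lemma sum_load : \sum_u load u = 2 * lp_value x.
Proof.
rewrite pair_big_dep /=.
(* Each edge comes from exactly two ordered adjacent pairs, one for either end. *)
rewrite (partition_big (fun p : G * G => [set p.1; p.2]) (mem (edges G))) /=;
  last by move=> p; exact: adj_edge.
rewrite /lp_value mulr_sumr; apply: eq_bigr => e /edgesP[[a b] /= [ab ->]].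
have nab := adj_neq ab.
rewrite (eq_bigl (mem [set (a, b); (b, a)])).
  rewrite big_setU1 /= ?big_set1 /= ?inE ?xpair_eqE ?(negbTE nab) //.
  by rewrite [in X in _ + X]setUC; ring.
move=> [c d]; rewrite !inE !xpair_eqE /=; apply/andP/orP.
  move=> [cd /eqP eq].
  have ncd := adj_neq cd.
  have /set2P[cE|cE] : c \in [set a; b] by rewrite -eq set21.
    have /set2P[dE|->] : d \in [set a; b] by rewrite -eq set22.
      by rewrite cE dE eqxx in ncd.
    by left; rewrite cE !eqxx.
  have /set2P[dE|dE] : d \in [set a; b] by rewrite -eq set22.
    by right; rewrite cE dE !eqxx.
  by rewrite cE dE eqxx in ncd.
by move=> [/andP[/eqP-> /eqP->]|/andP[/eqP-> /eqP->]]; rewrite ?(adj_sym b) ab // setUC.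
Qed.

End VertexLoad.

(** * Edges of a connected component *)

Section Component.
Variables (G : sgraph) (C : {set G}).
Hypothesis clC : forall u w, u \in C -> adj u w -> w \in C.
Hypothesis coC : {in C &, forall u w, connect (@adj G) u w}.

(** A set that no edge leaves is closed under [connect], so once nonempty it would contain all of
    C. *)
Lemma exit_edge (S : {set G}) : S \subset C -> S != set0 -> S != C ->
  exists u w, [/\ u \in S, w \in C, w \notin S & adj u w].
Proof.
move=> SC /set0Pn[s sS] nSC.
have /subsetPn[t tC tS] : ~~ (C \subset S).
  by apply: contraNN nSC => CS; rewrite eqEsubset SC.
case: (boolP [exists u in S, exists w, adj u w && (w \notin S)]) => [|nex].
  case/exists_inP => u uS /existsP[w /andP[uw wS]].
  by exists u, w; rewrite uS wS uw (clC (subsetP SC _ uS) uw).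
have clS : closed (@adj G) (mem S).
  apply: intro_closed => [|u w uw uS]; first exact/sym_connect_sym/adj_sym.
  apply: contraNT nex => wS.
  by apply/exists_inP; exists u => //; apply/existsP; exists w; rewrite uw.
have := closed_connect clS (coC (subsetP SC _ sS) tC).
by rewrite /= sS (negbTE tS).
Qed.

(** Twice the number of edges spanned by S. *)
Definition arcs (S : {set G}) : nat :=
  \sum_(u in S) #|[set w in S | adj u w]|.

(** The new edge is seen from both of its ends, hence the 2. *)
Lemma arcs_grow (S : {set G}) (u w : G) :
  u \in S -> w \notin S -> adj u w -> (arcs S + 2 <= arcs (w |: S))%N.
Proof.
move=> uS wS uw; rewrite /arcs big_setU1 //= [in X in (_ <= _ + X)%N](bigD1 u) //=.
rewrite (bigD1 u) //=.
have wu : (1 <= #|[set v in w |: S | adj w v]|)%N.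
  by apply/card_gt0P; exists u; rewrite !inE uS orbT adj_sym.
have uS' : (#|[set v in S | adj u v]| + 1 <= #|[set v in w |: S | adj u v]|)%N.
  rewrite (cardsD1 w [set v in w |: S | adj u v]) !inE eqxx uw /= addnC leq_add2l.
  apply/subset_leq_card/subsetP => v; rewrite !inE => /andP[vS ->].
  by rewrite vS orbT !andbT; apply: contraNneq wS => <-.
have mono : (\sum_(v in S | v != u) #|[set t in S | adj v t]| <=
             \sum_(v in S | v != u) #|[set t in w |: S | adj v t]|)%N.
  apply: leq_sum => v _; apply/subset_leq_card/subsetP => t.
  by rewrite !inE => /andP[-> ->]; rewrite orbT.
by lia.
Qed.

(** A connected graph of order k has at least k - 1 edges, doubled and written without subtraction.
    A set grown from one vertex along outgoing edges gains at least two arcs per new vertex until it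
    fills C. *)
Lemma sum_degree_connected : (2 * #|C| <= \sum_(u in C) degree u + 2)%N.
Proof.
have [->|] := eqVneq C set0; first by rewrite cards0.
case/set0Pn => r rC.
pose P (S : {set G}) :=
  [&& S \subset C, S != set0 & (2 * #|S| <= arcs S + 2)%N].
have P1 : P [set r].
  by rewrite /P sub1set rC cards1 leq_addl -card_gt0 cards1.
(* An edge leaving a maximal such S would allow S to grow. *)
have [S /maxsetP[/and3P[SC S0 ineq] maxS] _] := maxset_exists P1.
have SE : S = C.
  apply/eqP; apply: contraT => nSC.
  have [u [w [uS wC wS uw]]] := exit_edge SC S0 nSC.
  suff Pw : P (w |: S).
    by move: wS; rewrite -(maxS _ Pw (subsetU1 _ _)) setU11.
  rewrite /P subUset sub1set wC SC /= cardsU1 wS.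
  have -> /= : w |: S != set0 by apply/set0Pn; exists w; rewrite setU11.
  by have := arcs_grow uS wS uw; lia.
rewrite SE in ineq; apply: (leq_trans ineq); rewrite leq_add2r.
apply: leq_sum => u _; apply/subset_leq_card/subsetP => w.
by rewrite !inE => /andP[].
Qed.

Lemma degree_pos (u : G) : (1 < #|C|)%N -> u \in C -> (0 < degree u)%N.
Proof.
move=> C1 uC.
have [] := @exit_edge [set u]; first by rewrite sub1set.
- by apply/set0Pn; exists u; rewrite set11.
- by apply: contraTneq C1 => <-; rewrite cards1.
move=> _ [w [/set1P-> _ _ uw]].
by apply/card_gt0P; exists w; rewrite inE.
Qed.

(** Degrees all at most 1 would sum to at most |C|, which is below 2|C| - 2. *)
Lemma exists_degree_ge2 : (2 < #|C|)%N -> exists2 u, u \in C & (1 < degree u)%N.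
Proof.
move=> C2; case: (boolP [exists u in C, (1 < degree u)%N]) => [|no].
  by case/exists_inP => u; exists u.
have : (\sum_(u in C) degree u <= \sum_(u in C) 1)%N.
  apply: leq_sum => u uC; rewrite leqNgt; apply: contraNN no => du.
  by apply/exists_inP; exists u.
by have := sum_degree_connected; rewrite sum1_card; lia.
Qed.

End Component.

(** * Deficits *)

Section Deficit.
Variables (R : realType) (G : sgraph) (x : {set G} -> R).
Hypothesis xF : feasible x.

Definition deficit (u : G) : R := 1 - load x u.

Lemma deficit_edge (u v : G) :
  adj u v -> 1 - x [set u; v] <= deficit u + deficit v.
Proof.
move=> uv; have := xF.1 _ (adj_edge uv).
by rewrite (sum_edelta _ uv) /deficit; lra.
Qed.

Lemma edge_le_load (u v : G) : adj u v -> x [set u; v] <= load x u.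
Proof.
move=> uv; rewrite /load (bigD1 v) //= lerDl.
by apply: sumr_ge0 => w /andP[uw _]; exact/xF.2/adj_edge.
Qed.

(** For a neighbour v, feasibility at uv gives load(u) <= 1 - (load(v) - x(uv)), and x(uv) is one of
    the nonnegative terms of load(v). *)
Lemma deficit_ge0 (u : G) : (0 < degree u)%N -> 0 <= deficit u.
Proof.
case/card_gt0P => v; rewrite inE => uv; have vu : adj v u by rewrite adj_sym.
have := deficit_edge uv; have := edge_le_load vu.
by rewrite [in X in X -> _]setUC /deficit; lra.
Qed.

Lemma sum1_adj (u : G) : \sum_(v | adj u v) (1 : R) = (degree u)%:R.
Proof. by rewrite -(natr_sum R _ _ (fun=> 1%N)) sum1dep_card. Qed.

Lemma deficit_star (u : G) :
  (degree u)%:R - 1 <=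
  ((degree u)%:R - 1) * deficit u + \sum_(v | adj u v) deficit v.
Proof.
have : \sum_(v | adj u v) (1 - x [set u; v])
       <= \sum_(v | adj u v) (deficit u * 1 + deficit v).
  by apply: ler_sum => v uv; rewrite mulr1; exact: deficit_edge.
rewrite sumrB big_split /= -mulr_sumr sum1_adj -/(load x u).
have -> : load x u = 1 - deficit u by rewrite /deficit; ring.
by lra.
Qed.

Variables (C : {set G}) (Delta : nat).
Hypothesis clC : forall u w, u \in C -> adj u w -> w \in C.
Hypothesis coC : {in C &, forall u w, connect (@adj G) u w}.
Hypothesis C2 : (2 < #|C|)%N.
Hypothesis degD : forall u : G, (degree u <= Delta)%N.

Let S := \sum_(u in C) deficit u.

Let d0 (u : G) : u \in C -> 0 <= deficit u.
Proof. by move=> uC; apply: deficit_ge0; apply: (degree_pos clC coC) uC; lia. Qed.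

Lemma sum_nbrs_deficit_le (u : G) : u \in C ->
  \sum_(v | adj u v) deficit v <= S - deficit u.
Proof.
move=> uC; rewrite /S [X in _ <= X - _](bigD1 u) //= [X in _ <= X - _]addrC addrK.
rewrite [leRHS](bigID (adj u)) /= (eq_bigl (fun i => ((i \in C) && (i != u)) && adj u i)).
  by rewrite lerDl; apply: sumr_ge0 => v /andP[/andP[vC _] _]; exact: d0.
move=> v; case: (boolP (adj u v)) => uv; last by rewrite andbF.
by rewrite (clC uC uv) eq_sym (adj_neq uv).
Qed.

(** Take u of degree at least 2. Bounding the neighbours in [deficit_star] by S - d(u) leaves the
    coefficient deg u - 2 >= 0 on d(u); then d(u) <= S gives deg u - 1 <= (deg u - 1) S. *)
Lemma sum_deficit_ge1 : 1 <= S.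
Proof.
have [u uC du] := exists_degree_ge2 clC coC C2.
have := deficit_star u; have := sum_nbrs_deficit_le uC.
have : 1 <= (degree u)%:R - 1 :> R.
  by rewrite lerBrDr -(natrD _ 1 1) ler_nat.
have : deficit u <= S.
  by rewrite /S (bigD1 u) //= lerDl sumr_ge0 // => v /andP[vC _]; exact: d0.
by nra.
Qed.

(** Sum [deficit_star] over C: d(v) enters deg v - 1 times through v itself and once through each
    neighbour of v. The left-hand sides total at least |C| - 2 because C is connected. *)
Lemma sum_weighted_deficit :
  #|C|%:R - 2 <= \sum_(v in C) (2 * (degree v)%:R - 1) * deficit v.
Proof.
have : \sum_(u in C) ((degree u)%:R - 1) <=
   \sum_(u in C) (((degree u)%:R - 1) * deficit u + \sum_(v | adj u v) deficit v).
  by apply: ler_sum => u _; exact: deficit_star.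
rewrite [leRHS]big_split /= (exchange_big_dep (mem C)) /=; last by move=> u v; exact: clC.
have -> : \sum_(v in C) \sum_(u in C | adj u v) deficit v =
          \sum_(v in C) (degree v)%:R * deficit v.
  apply: eq_bigr => v vC; rewrite -sum1_adj mulr_suml.
  apply: eq_big => [u|u _]; last by rewrite mul1r.
  rewrite adj_sym; case: (boolP (adj v u)) => vu; last by rewrite andbF.
  by rewrite (clC vC vu).
rewrite -big_split /= sumrB -natr_sum sumr_const.
have := sum_degree_connected clC coC; rewrite -(ler_nat R) natrD natrM.
move=> h1; set E := (X in _ <= X -> _) => h2.
have -> : \sum_(v in C) (2 * (degree v)%:R - 1) * deficit v = E; last by lra.
by apply: eq_bigr => v _; ring.
Qed.

Lemma sum_deficit_ge : #|C|%:R - 2 <= (2 * Delta%:R - 1) * S.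
Proof.
apply: (le_trans sum_weighted_deficit); rewrite mulr_sumr; apply: ler_sum => v vC.
apply: ler_wpM2r; first exact: d0.
by rewrite lerD2r ler_wpM2l // ler_nat.
Qed.

Lemma Delta_ge2 : (1 < Delta)%N.
Proof.
have [u _ du] := exists_degree_ge2 clC coC C2.
exact: leq_trans du (degD u).
Qed.

Lemma component_bound : #|C|%:R <= (2 * Delta%:R + 1) * S.
Proof.
have := sum_deficit_ge1; have := sum_deficit_ge.
have D2 : 2 <= Delta%:R :> R by rewrite (ler_nat _ 2) Delta_ge2.
(* The second estimate suffices for large C because (2 Delta + 1)(|C| - 2) - (2 Delta - 1)|C| =
   2(|C| - (2 Delta + 1)). *)
have [] := leqP #|C| (2 * Delta + 1); rewrite -?(ltr_nat R) -?(ler_nat R) natrD natrM => *; nra.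
Qed.

Lemma component_bound_eq : #|C|%:R = (2 * Delta%:R + 1) * S ->
  #|C| = (2 * Delta + 1)%N /\ S = 1.
Proof.
have := sum_deficit_ge1; have := sum_deficit_ge.
have D2 : 2 <= Delta%:R :> R by rewrite (ler_nat _ 2) Delta_ge2.
move=> h1 h2 eq.
have cardC : #|C|%:R = 2 * Delta%:R + 1 :> R.
  have [lt|gt|->] := ltngtP #|C| (2 * Delta + 1); last by rewrite natrD natrM.
    by move: lt; rewrite -(ltr_nat R) natrD natrM; nra.
  by move: gt; rewrite -(ltr_nat R) natrD natrM; nra.
split; last by nra.
by apply/eqP; rewrite -(eqr_nat R) cardC natrD natrM.
Qed.

Lemma component_center : #|C|%:R = (2 * Delta%:R + 1) * S ->
  exists v, [/\ v \in C, degree v = Delta,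
    forall u, u \in C -> (1 < degree u)%N -> u != v -> adj u v &
    forall u, u \in C -> (2 < degree u)%N -> u = v].
Proof.
move=> eq; have [cardC S1] := component_bound_eq eq.
have [v vC dv] : exists2 v, v \in C & 0 < deficit v.
  case: (boolP [exists v in C, 0 < deficit v]) => [/exists_inP[v]|no]; first by exists v.
  suff : S <= 0 by rewrite S1 ler10.
  apply: sumr_le0 => v vC; rewrite leNgt; apply: contraNN no => dv.
  by apply/exists_inP; exists v.
have pair u : u \in C -> u != v ->
    1 = deficit u + (deficit v + \sum_(i in C | (i != u) && (i != v)) deficit i).
  move=> uC uv; rewrite -[LHS]S1 /S (bigD1 u) //= (bigD1 v) /=; last by rewrite vC eq_sym.
  by congr (_ + (_ + _)); apply: eq_bigl => i; rewrite andbA.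
have pair_le u : u \in C -> u != v -> deficit u + deficit v <= 1.
  move=> uC uv; rewrite [leRHS](pair u uC uv) [leRHS]addrA lerDl.
  by apply: sumr_ge0 => w /andP[wC _]; exact: d0.
(* [deficit_star] with d(v) split off: the vertices other than u and v share 1 - d(u) - d(v), and
   d(v) counts only if v is a neighbour of u. *)
have star u : u \in C -> u != v ->
    (degree u)%:R - 1 <= ((degree u)%:R - 1) * deficit u
                 + (1 - deficit u - deficit v) + (adj u v)%:R * deficit v.
  move=> uC uv; apply: (le_trans (deficit_star u)); rewrite -addrA lerD2l.
  case: (boolP (adj u v)) => auv.
    by have := sum_nbrs_deficit_le uC; rewrite S1 mul1r; lra.
  rewrite mul0r addr0 [X in _ <= X - _ - _](pair u uC uv).
  set E := \sum_(i in C | _) _.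
  have -> : deficit u + (deficit v + E) - deficit u - deficit v = E by ring.
  rewrite /E [leRHS](bigID (adj u)) /=.
  rewrite (eq_bigl (fun i => (i \in C) && ((i != u) && (i != v)) && adj u i)).
    by rewrite lerDl; apply: sumr_ge0 => w /andP[/andP[wC _] _]; exact: d0.
  move=> w; case: (boolP (adj u w)) => uw; last by rewrite andbF.
  rewrite (clC uC uw) [w == u]eq_sym (adj_neq uw) /= andbT.
  by apply/esym; apply: contraNneq auv => <-.
exists v; split=> //.
(* A smaller degree at v, where d(v) > 0, would make the weighted estimate strict, giving |C| - 2 <
   2 Delta - 1. *)
- apply/eqP; rewrite eqn_leq degD leqNgt; apply/negP => lt.
  have : #|C|%:R - 2 < (2 * Delta%:R - 1) * S.
    apply: (le_lt_trans sum_weighted_deficit).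
    rewrite mulr_sumr (bigD1 v) //= [ltRHS](bigD1 v) //=.
    apply: ltr_leD.
      by rewrite ltr_pM2r // ltrD2r ltr_pM2l // ltr_nat.
    apply: ler_sum => u /andP[uC _].
    apply: ler_wpM2r; first exact: d0.
    by rewrite lerD2r ler_wpM2l // ler_nat.
  by rewrite cardC S1 natrD natrM; lra.
(* Without adjacency, d(u) <= 1 - d(v) turns [star] into deg u - 1 <= (deg u - 1)(1 - d(v)), which
   is false as d(v) > 0. *)
- move=> u uC du uv; apply: contraT => nuv; have := star u uC uv.
  rewrite (negbTE nuv) mul0r.
  have : 2 <= (degree u)%:R :> R by rewrite (ler_nat _ 2).
  have := pair_le u uC uv.
  by nra.
(* Even with adjacency, [star] and d(u) <= 1 - d(v) yield (deg u - 2) d(v) <= 0, which is false for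
   degree at least 3. *)
- move=> u uC du; apply/eqP; apply: contraT => uv; have := star u uC uv.
  have : 3 <= (degree u)%:R :> R by rewrite (ler_nat _ 3).
  have := pair_le u uC uv.
  have : (adj u v)%:R * deficit v <= deficit v by case: (adj u v); rewrite ?mul1r ?mul0r // ltW.
  by nra.
Qed.

End Deficit.

(** * Subdivided stars *)

(* [None] is the centre, [Some (i, false)] its i-th neighbour and             *)
(* [Some (i, true)] the leaf attached to it.                                   *)
Definition spider_adj (n : nat) : rel (option ('I_n * bool)) := fun a b =>
  match a, b with
  | None, Some (_, c) | Some (_, c), None => ~~ c
  | Some (i, c), Some (j, d) => (i == j) && (c != d)
  | None, None => false
  end.

Section SpiderIso.
Variable n : nat.

Lemma star_edge_in (i : 'I_n) : [set None; Some i] \in edges (star n).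
Proof. exact: (@adj_edge (star n) None (Some i)). Qed.

Definition star_edge (i : 'I_n) : {e | e \in edges (star n)} :=
  exist _ [set None; Some i] (star_edge_in i).

Definition spider_to_Tstar (a : option ('I_n * bool)) : Tstar n :=
  match a with
  | None => inl None
  | Some (i, false) => inr (star_edge i)
  | Some (i, true) => inl (Some i)
  end.

Lemma spider_to_Tstar_inj : injective spider_to_Tstar.
Proof.
move=> [[i []]|] [[j []]|] //=; first by move=> [->].
by move=> [/set2_inj[->]].
Qed.

Lemma spider_to_Tstar_adj a b :
  adj (spider_to_Tstar a) (spider_to_Tstar b) = spider_adj a b.
Proof.
by case: a b => [[i []]|] [[j []]|] //=; rewrite /adj /= ?inE ?andbF ?andbT // eq_sym.
Qed.

Lemma card_star_edges : #|edges (star n)| = n.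
Proof.
have -> : edges (star n) = [set [set None; Some i] | i in 'I_n].
  apply/setP => e; apply/edgesP/imsetP => [[[a b] /= [ab ->]]|[i _ ->]].
    by move: a b ab => [i|] [j|] //= _; [exists i; rewrite // setUC|exists j].
  by exists (None, Some i).
by rewrite card_imset ?card_ord // => i j /set2_inj [].
Qed.

Lemma card_Tstar : #|Tstar n| = (2 * n + 1)%N.
Proof.
rewrite card_sum card_option card_ord card_sig card_star_edges.
by lia.
Qed.

Lemma card_spider : #|{: option ('I_n * bool)}| = (2 * n + 1)%N.
Proof. by rewrite card_option card_prod card_ord card_bool; lia. Qed.

Lemma spider_to_Tstar_bij : bijective spider_to_Tstar.
Proof.
by apply: inj_card_bij; [exact: spider_to_Tstar_inj|rewrite card_spider card_Tstar].
Qed.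

(** Deleting the centre leaves a perfect matching, which pairs each leaf with its subdivision
    vertex. This matching supports the optimal solution in the converse. *)
Lemma Tstar_unique_nbr (a : Tstar n) : a != inl None ->
  exists b, [/\ adj a b, b != inl None &
             forall c, adj a c -> c != inl None -> c = b].
Proof.
have [g hK gK] := spider_to_Tstar_bij.
rewrite -(gK a); case: (g a) => [[i c]|] // _.
exists (spider_to_Tstar (Some (i, ~~ c))); split.
- by rewrite spider_to_Tstar_adj /= eqxx; case: c.
- by rewrite -[inl None]/(spider_to_Tstar None) (inj_eq spider_to_Tstar_inj).
move=> b; rewrite -(gK b); case: (g b) => [[j d]|] //.
rewrite spider_to_Tstar_adj /= => /andP[/eqP<- cd] _.
by congr (spider_to_Tstar (Some (_, _))); case: c d cd => [] [].
Qed.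

End SpiderIso.

(** * Recognising T* from its centre and degree constraints *)

Section ComponentIso.
Variables (G : sgraph) (C : {set G}) (Delta : nat) (v : G).
Hypothesis clC : forall u w, u \in C -> adj u w -> w \in C.
Hypothesis coC : {in C &, forall u w, connect (@adj G) u w}.
Hypothesis cardC : #|C| = (2 * Delta + 1)%N.
Hypothesis D0 : (0 < Delta)%N.
Hypothesis vC : v \in C.
Hypothesis dv : degree v = Delta.
Hypothesis ge2 : forall u, u \in C -> (1 < degree u)%N -> u != v -> adj u v.
Hypothesis ge3 : forall u, u \in C -> (2 < degree u)%N -> u = v.

Let N : {set G} := [set w | adj v w].
Let W : {set G} := C :\: (v |: N).

Let degW w : w \in W -> degree w = 1%N.
Proof.
rewrite !inE negb_or => /andP[/andP[wv vw] wC]; apply/eqP.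
rewrite eqn_leq (degree_pos clC coC) // ?cardC; last by lia.
rewrite andbT leqNgt; apply: contraNN vw => dw.
by rewrite adj_sym ge2.
Qed.

Let leaf_unique (w a b : G) : degree w = 1%N -> adj w a -> adj w b -> a = b.
Proof.
move/eqP/cards1P => [c cE] wa wb.
have /set1P-> : a \in [set c] by rewrite -cE inE.
by have /set1P-> : b \in [set c] by rewrite -cE inE.
Qed.

(** On [W], where all degrees are 1, this is the unique neighbour; the default [v] is never reached
    there. *)
Let parent (w : G) : G := odflt v [pick p | adj w p].

Let parentP w : w \in W -> adj w (parent w).
Proof.
move=> wW; rewrite /parent; case: pickP => //= no.
have := degW wW; rewrite /degree (_ : [set _ | _] = set0) ?cards0 //.
by apply/setP => p; rewrite !inE no.
Qed.

(** Otherwise w and its parent both have degree 1 and form a closed pair that misses v, against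
    connectedness. *)
Let parentN w : w \in W -> parent w \in N.
Proof.
move=> wW; have wp := parentP wW; set p := parent w in wp *.
have wC : w \in C by move: wW; rewrite inE => /andP[].
have pC := clC wC wp.
apply: contraT => pN.
have pv : p != v.
  move: wW; rewrite !inE negb_or => /andP[/andP[_ vw] _].
  by apply: contraNneq vw => <-; rewrite adj_sym.
have pW : p \in W by rewrite !inE negb_or pv pC; move: pN; rewrite inE => ->.
have cl : closed (@adj G) (mem [set w; p]).
  apply: intro_closed => [|a b ab]; first exact/sym_connect_sym/adj_sym.
  move=> /set2P[aE|aE]; rewrite aE in ab; apply/set2P.
    by right; exact: (leaf_unique (degW wW) ab).
  by left; apply: (leaf_unique (degW pW) ab); rewrite adj_sym.
have := closed_connect cl (coC wC vC).
rewrite /= set21 => /esym/set2P[vE|vE]; last by rewrite vE eqxx in pv.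
by move: wW; rewrite -vE !inE eqxx.
Qed.

(** Two leaves with a common parent would, together with v, give that parent degree at least 3,
    which only v may have. *)
Let parent_inj : {in W &, injective parent}.
Proof.
move=> a b aW bW ab; apply/eqP; apply: contraT => nab.
have pN := parentN aW; set p := parent a in ab pN.
have vp : adj v p by move: pN; rewrite inE.
have : (2 < degree p)%N.
  have -> : 3%N = #|[set v; a; b]|.
    have va w : w \in W -> v != w by rewrite !inE negb_or eq_sym => /andP[/andP[]].
    by rewrite setUC cardsU1 cards2 !inE negb_or eq_sym va // eq_sym nab va.
  apply/subset_leq_card/subsetP => w; rewrite !inE => /orP[/orP[]|] /eqP->.
  - by rewrite adj_sym.
  - by rewrite adj_sym parentP.
  - by rewrite adj_sym ab parentP.
by move/(ge3 (clC vC vp)) => pv; move: vp; rewrite pv adj_irr.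
Qed.

Let cardW : #|W| = #|N|.
Proof.
have NC : v |: N \subset C.
  apply/subsetP => w /setU1P[->//|]; rewrite inE; exact: clC.
have cN : #|N| = Delta by exact: dv.
rewrite /W cardsD (setIidPr NC) cardC cardsU1 cN !inE adj_irr /=.
by lia.
Qed.

Let parent_onto : parent @: W = N.
Proof.
apply/eqP; rewrite eqEcard card_in_imset // cardW leqnn andbT.
by apply/subsetP => _ /imsetP[w wW ->]; exact: parentN.
Qed.

Lemma component_spider :
  exists2 phi : induced C -> option ('I_Delta * bool), bijective phi &
    forall a b, spider_adj (phi a) (phi b) = adj a b.
Proof.
have [p0 p0N] : exists p, p \in N by apply/card_gt0P; rewrite [#|_|]dv.
have [rank rank_inj] : exists rank : G -> 'I_Delta, {in N &, injective rank}.
  exists (fun p => cast_ord dv (enum_rank_in p0N p)).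
  by move=> a b aN bN /cast_ord_inj; exact: enum_rank_in_inj.
pose phi (a : induced C) : option ('I_Delta * bool) :=
  if val a == v then None else
  if val a \in N then Some (rank (val a), false)
  else Some (rank (parent (val a)), true).
have memW (a : induced C) : val a != v -> val a \notin N -> val a \in W.
  by move=> av aN; rewrite 2!inE negb_or (valP a) aN inE av.
have phi_inj : injective phi.
  move=> a b; rewrite /phi.
  case: eqVneq => [av|av]; case: eqVneq => [bv|bv]; try by do 1?case: ifP.
    by move=> _; apply: val_inj; rewrite av.
  case: ifPn => aN; case: ifPn => bN // [] eq; apply: val_inj.
    exact: rank_inj.
  by apply: parent_inj; rewrite ?memW //; apply: rank_inj; rewrite ?parentN ?memW.
exists phi; first by apply: inj_card_bij => //; rewrite card_spider card_sig cardC.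
(* A neighbour of v has degree at most 2: besides v it only sees its leaf. *)
have adjN p q : p \in N -> adj p q -> q != v -> q \in W /\ parent q = p.
  move=> pN pq qv; have := pN; rewrite -parent_onto => /imsetP[w wW pE].
  suff -> : q = w by rewrite -pE.
  have vp : adj v p by move: pN; rewrite inE.
  apply/eqP; apply: contraT => qw.
  have wv : w != v by move: wW; rewrite !inE negb_or => /andP[/andP[]].
  have : (2 < degree p)%N.
    have -> : 3%N = #|[set v; q; w]|.
      by rewrite setUC cardsU1 cards2 !inE negb_or [v == q]eq_sym qv wv [w == q]eq_sym qw.
    apply/subset_leq_card/subsetP => u; rewrite !inE => /orP[/orP[]|] /eqP-> //.
      by rewrite adj_sym.
    by rewrite adj_sym pE parentP.
  by move/(ge3 (clC vC vp)) => pv; move: vp; rewrite pv adj_irr.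
have adjNW p w : p \in N -> w \in W -> adj p w = (rank p == rank (parent w)).
  move=> pN wW; rewrite (inj_in_eq rank_inj) ?parentN //.
  apply/idP/eqP => [pw|->]; last by rewrite adj_sym parentP.
  by apply: (leaf_unique (degW wW)); rewrite ?parentP // adj_sym.
have WN w : w \in W -> w \notin N by rewrite inE => /andP[]; rewrite !inE negb_or => /andP[].
move=> a b; have -> : adj a b = @adj G (val a) (val b) by []; rewrite /phi.
case: eqVneq => [->|av]; case: eqVneq => [->|bv].
- by rewrite adj_irr.
- by case: ifPn; rewrite inE; case: (adj v _).
- by rewrite (adj_sym _ v); case: ifPn; rewrite inE; case: (adj v _).
case: ifPn => aN; case: ifPn => bN /=; rewrite ?andbF ?andbT.
- by apply/esym/negP => /(adjN _ _ aN) /(_ bv) [/WN]; rewrite bN.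
- by rewrite adjNW ?memW.
- by rewrite adj_sym adjNW ?memW // eq_sym.
(* Two vertices of [W] are not adjacent: the only neighbour of a is its parent, which lies in [N],
   while b does not. *)
- apply/esym/negP => ab; move: (memW _ av aN) (memW _ bv bN) => aW bW.
  have := parentN aW; rewrite (leaf_unique (degW aW) (parentP aW) ab).
  by rewrite (negbTE bN).
Qed.

Lemma component_iso : isomorphic (induced C) (Tstar Delta).
Proof.
have [phi bphi phiE] := component_spider.
exists (@spider_to_Tstar Delta \o phi).
  exact: bij_comp (spider_to_Tstar_bij Delta) bphi.
by move=> a b; rewrite -phiE -spider_to_Tstar_adj.
Qed.

End ComponentIso.

(** * Lower bound *)

Section LowerBound.
Variables (R : realType) (G : sgraph) (Z : {set G}).
Hypothesis indZ : forall u v, adj u v -> u \in Z -> v \notin Z.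
Hypothesis mateZ : forall v, v \notin Z ->
  exists w, [/\ adj v w, w \notin Z & forall c, adj v c -> c \notin Z -> c = w].

(** On edges, the indicator of the perfect matching that [mateZ] provides outside [Z]. *)
Let x (e : {set G}) : R := [disjoint e & Z]%:R.

Let x2 u v : x [set u; v] = ((u \notin Z) && (v \notin Z))%:R.
Proof. by rewrite /x disjoints_subset subUset !sub1set !inE. Qed.

Let loadE v : load x v = (v \notin Z)%:R.
Proof.
rewrite /load; case: (boolP (v \in Z)) => vZ.
  by rewrite big1 // => w _; rewrite x2 vZ.
have [w [vw wZ uw]] := mateZ vZ.
rewrite (bigD1 w) //= big1 ?addr0 => [|c /andP[vc cw]]; first by rewrite x2 vZ wZ.
rewrite x2 vZ; case: (boolP (c \in Z)) => // cZ.
by rewrite (uw c vc cZ) eqxx in cw.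
Qed.

(** Loads are 1 off [Z] and 0 on [Z], so the constraint at a matching edge reads 1 + 1 - 1 and at an
    edge meeting [Z] it reads 1 + 0 - 0. Twice the value counts the vertices outside [Z]. *)
Lemma frac_induced_matching_ge :
  #|G|%:R - #|Z|%:R <= 2 * frac_induced_matching R G.
Proof.
have xF : feasible x.
  split=> e; last by rewrite ler0n.
  move=> /edgesP[[u v] /= [uv ->]]; rewrite (sum_edelta _ uv) !loadE x2.
  have := indZ uv; case: (u \in Z) => /= [->//|]; first by rewrite add0r subr0.
  by case: (v \in Z) => /= _; lra.
have := (frac_induced_matching_max R G).2 x xF.
rewrite -(ler_pM2l (ltr0n R 2)) -sum_load; apply: le_trans.
under eq_bigr do rewrite loadE.
rewrite -natr_sum -big_mkcond /= sum1dep_card.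
rewrite -(cardsC Z) natrD addrC addKr ler_nat.
by apply/subset_leq_card/subsetP => v; rewrite !inE.
Qed.

End LowerBound.

(** * Partition into connected components *)

Section Components.
Variable G : sgraph.

Lemma connect_equivalence : {in [set: G] & &, equivalence_rel (connect (@adj G))}.
Proof.
move=> u v w _ _ _; split=> [|uv]; first exact: connect0.
exact: (same_connect (sym_connect_sym (@adj_sym G)) uv).
Qed.

Lemma components_partition : partition (components G) [set: G].
Proof. exact/equivalence_partitionP/connect_equivalence. Qed.

Lemma componentE (C : {set G}) (u w : G) :
  C \in components G -> u \in C -> (w \in C) = connect (@adj G) u w.
Proof.
case/imsetP => r _ ->; rewrite !inE /= => ru.
by have [_ /(_ ru)] := connect_equivalence (in_setT r) (in_setT u) (in_setT w).
Qed.

Lemma component_closed (C : {set G}) : C \in components G ->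
  forall u w, u \in C -> adj u w -> w \in C.
Proof. by move=> CG u w uC uw; rewrite (componentE _ CG uC) connect1. Qed.

Lemma component_connected (C : {set G}) : C \in components G ->
  {in C &, forall u w, connect (@adj G) u w}.
Proof. by move=> CG u w uC; rewrite (componentE _ CG uC). Qed.

Lemma component_eq (C D : {set G}) (u : G) :
  C \in components G -> D \in components G -> u \in C -> u \in D -> C = D.
Proof.
by move=> CG DG uC uD; apply/setP => w; rewrite (componentE _ CG uC) (componentE _ DG uD).
Qed.

Lemma sum_components (R : nmodType) (F : G -> R) :
  \sum_u F u = \sum_(C in components G) \sum_(u in C) F u.
Proof.
by rewrite -(set_partition_big _ components_partition); apply: eq_bigl => u; rewrite inE.
Qed.

Lemma mem_some_component (u : G) : exists2 C, C \in components G & u \in C.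
Proof.
by exists (pblock (components G) u);
  rewrite ?pblock_mem ?mem_pblock ?(cover_partition components_partition) ?inE.
Qed.

End Components.

(** Since C is closed under adjacency, neighbours in G are neighbours in the induced graph, so the
    order of T* and its matching off the centre carry over; z is the preimage of the centre. *)
Lemma isomorphic_Tstar (G : sgraph) (C : {set G}) (n : nat) :
  (forall u w, u \in C -> adj u w -> w \in C) ->
  isomorphic (induced C) (Tstar n) ->
  exists z, [/\ z \in C, #|C| = (2 * n + 1)%N &
    forall w, w \in C -> w != z ->
      exists b, [/\ adj w b, b != z & forall c, adj w c -> c != z -> c = b]].
Proof.
move=> clC [f [g fK gK] fE]; exists (val (g (inl None))); split.
- exact: valP.
- by rewrite -card_Tstar -(bij_eq_card (Bijective fK gK)) card_sig.
move=> w wC wz; pose w' : induced C := Sub w wC.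
have [|b [wb bn bu]] := @Tstar_unique_nbr n (f w').
  by apply: contraNneq wz => <-; rewrite fK.
exists (val (g b)); split.
- by move: wb; rewrite -[X in adj _ X]gK fE.
- by apply: contraNneq bn => /val_inj /(can_inj gK) ->.
move=> c wc cz; have cC := clC w c wC wc; pose c' : induced C := Sub c cC.
rewrite -(bu (f c')) ?fK ?fE //.
by apply: contraNneq cz => <-; rewrite fK.
Qed.

(** * Assembling the components *)

Unset Implicit Arguments.

Theorem theorem1 (R : realType) (Delta : nat) (G : sgraph) :
  (0 < Delta)%N ->
  (max_degree G <= Delta)%N ->
  (forall C : {set G}, C \in components G -> (2 < #|C|)%N) ->
  frac_induced_matching R G <= Delta%:R / (2 * Delta + 1)%:R * #|G|%:R
  /\ (frac_induced_matching R G = Delta%:R / (2 * Delta + 1)%:R * #|G|%:R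
      <-> forall C : {set G}, C \in components G ->
            isomorphic (induced C) (Tstar Delta)).
Proof.
move=> D0 maxD big.
have degD (u : G) : (degree u <= Delta)%N by apply: leq_trans maxD; exact: leq_bigmax.
(* The optimum is attained, so the deficits of an actual optimal solution can be examined. *)
have [[x xF xmax] _] := frac_induced_matching_max R G.
set nu := frac_induced_matching R G in xmax *.
have bound C : C \in components G ->
    0 <= (2 * Delta%:R + 1) * \sum_(u in C) deficit x u - #|C|%:R.
  move=> CG; rewrite subr_ge0.
  by apply: (component_bound xF (component_closed CG) (component_connected CG) (big C CG) degD).
have cardG : #|G| = (\sum_(C in components G) #|C|)%N.
  rewrite -sum1_card (sum_components (R := nat)).
  by apply: eq_bigr => C _; rewrite sum1_card.
(* The total deficit is n - 2 nu, so the left side, equal to twice Delta n - (2 Delta + 1) nu,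
   splits over the components. *)
have slack : (2 * Delta%:R + 1) * (#|G|%:R - 2 * nu) - #|G|%:R =
    \sum_(C in components G)
       ((2 * Delta%:R + 1) * \sum_(u in C) deficit x u - #|C|%:R).
  rewrite sumrB -mulr_sumr -sum_components -natr_sum -cardG -xmax -sum_load.
  by rewrite /deficit sumrB sumr_const.
have D1 : 0 < 2 * Delta%:R + 1 :> R by rewrite ltr_wpDl // mulr_ge0.
have slack0 : 0 <= (2 * Delta%:R + 1) * (#|G|%:R - 2 * nu) - #|G|%:R.
  by rewrite slack; exact: sumr_ge0.
rewrite natrD natrM mulrAC; split.
  by rewrite ler_pdivlMr //; nra.
split=> [eq C CG|iso].
  have nuE : nu * (2 * Delta%:R + 1) = Delta%:R * #|G|%:R.
    by rewrite eq divfK // gt_eqF.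
  have : \sum_(C in components G)
       ((2 * Delta%:R + 1) * \sum_(u in C) deficit x u - #|C|%:R) = 0.
    by rewrite -slack; lra.
  (* Nonnegative slacks with zero sum all vanish, so every component is tight. *)
  move/(psumr_eq0P bound)/(_ C CG)/eqP; rewrite subr_eq0 => /eqP/esym CE.
  have clC := component_closed CG; have coC := component_connected CG.
  have [v [vC dv ge2 ge3]] := component_center xF clC coC (big C CG) degD CE.
  have [cardC _] := component_bound_eq xF clC coC (big C CG) degD CE.
  exact: (component_iso clC coC cardC D0 vC dv ge2 ge3).
(* One centre is chosen in each component; [Z] collects them. *)
have /fin_all_exists[z zP] (C : {C | C \in components G}) :=
  isomorphic_Tstar (component_closed (valP C)) (iso _ (valP C)).
pose Z := [set z C | C : {C | C \in components G}].
have zC (C D : {C | C \in components G}) : z D \in val C -> D = C.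
  move=> zDC; apply: val_inj; have [zDD _ _] := zP D.
  exact: component_eq (valP D) (valP C) zDD zDC.
have cardZ : #|Z| = #|components G|.
  rewrite card_imset ?card_sig // => C D zCD.
  by apply: zC; rewrite zCD; have [] := zP D.
have ZE (C : {C | C \in components G}) u : u \in val C -> (u \in Z) = (u == z C).
  move=> uC; apply/imsetP/eqP => [[D _ uE]|->]; last by exists C.
  by rewrite uE (zC C D) // -uE.
have blockP (u : G) : exists C : {C | C \in components G}, u \in val C.
  by have [C CG uC] := mem_some_component u; exists (Sub C CG).
have indZ u v : adj u v -> u \in Z -> v \notin Z.
  move=> uv; have [C uC] := blockP u.
  rewrite !(ZE C) ?(component_closed (valP C) uC uv) // => /eqP <-.
  by rewrite eq_sym adj_neq.
have mateZ v : v \notin Z ->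
    exists w, [/\ adj v w, w \notin Z & forall c, adj v c -> c \notin Z -> c = w].
  have [C vC] := blockP v; rewrite (ZE C) // => vz.
  have clC := component_closed (valP C) vC.
  have [_ _ /(_ v vC vz) [w [vw wz uw]]] := zP C.
  exists w; split; rewrite ?(ZE C) ?clC // => c vc; rewrite (ZE C) ?clC //.
  exact: uw.
have := frac_induced_matching_ge R indZ mateZ.
rewrite -/nu cardZ.
have nE : #|G|%:R = (2 * Delta%:R + 1) * #|components G|%:R :> R.
  rewrite cardG (eq_bigr (fun=> 2 * Delta + 1)%N) => [|C CG].
    by rewrite sum_nat_const natrM natrD natrM mulrC.
  by have [_ <-] := zP (Sub C CG).
(* With c components, n = (2 Delta + 1) c, so n - c <= 2 nu reads Delta c <= nu and meets the upper
   bound. *)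
rewrite nE => nu_ge; rewrite nE in slack0.
apply/eqP; rewrite eq_le ler_pdivlMr // ler_pdivrMr //.
by apply/andP; split; nra.
Qed.
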